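(* Let $\theta(t)$ denote the unknown in any one of the following three second-order equations (all functions, parameters and terminology are defined in the context): (a) $\ \ddot\theta+\frac{\lambda_1}{2}\left(\frac{a}{r(t;e)}\right)^3\sin(2\theta-2f(t;e))=0$ (spin-orbit problem for the ellipsoid $\mathcal E_1$, $\theta=\theta_1$); (b) $\ \ddot\theta+\frac{\lambda_2}{2}\left(\frac{a}{r(t;e)}\right)^3\sin(2\theta-2f(t;e))=0$ (spin-orbit problem for the ellipsoid $\mathcal E_2$, $\theta=\theta_2$); (c) $\ \ddot\theta+\frac{\lambda_1}{2}\Big\{\left(\frac{a}{r(t;e)}\right)^3\sin(2\theta-2f(t;e))+\left(\frac{a}{r(t;e)}\right)^5\Big[\frac{25\,\hat q_1}{28}\sin(2\theta-2f(t;e))+\frac{25\,\lambda_1\sigma_1}{8}\sin(4\theta-4f(t;e))\Big]\Big\}=0$ (spin motion of $\mathcal E_1$, $\theta=\theta_1$, when $\mathcal E_2$ is a sphere). Then the following statements hold for each of these equations. (1) Let $m\in\mathbb Z$ and $n\in\mathbb Z\setminus\{0\}$. Being an $R_{\alpha,\beta}$-symmetric orbit (for some $(\alpha,\beta)\in\pi\mathbb Z\times\frac{\pi}{2}\mathbb Z$) associated to a standard $m:n$ spin-orbit resonance is equivalent, up to the identifications of solutions described in the context, to being a solution that satisfies the Dirichlet conditions $$\theta(\alpha)=\beta,\qquad \theta(\alpha+n\pi)=\beta+m\pi,$$ with $\alpha\in\{0,\pi\}$ and $\beta\in\{0,\frac{\pi}{2}\}$ (four combinations). Moreover, such a solution satisfies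 the symmetry property $\theta(t)=2\beta-\theta(2\alpha-t)$ for all $t$. (2) Let $m\in\mathbb Z$. Up to the same identifications, there are two independent types (i.e. not identified with each other) of $R_{\alpha,\beta}$-symmetric orbits representing a balanced $m:2$ spin-orbit resonance, and they are given by the solutions satisfying $$\text{Type } 0:\qquad \theta(0)=0,\quad \theta(\pi)=\frac{m\pi}{2},$$ $$\text{Type } \tfrac{\pi}{2}:\qquad \theta(0)=\frac{\pi}{2},\quad \theta(\pi)=\frac{(m+1)\pi}{2}.$$ Moreover, the corresponding symmetry relations are $\theta(t)=-\theta(-t)$ for type $0$ and $\theta(t)=\pi-\theta(-t)$ for type $\frac{\pi}{2}$, for all $t$.
   Context: **Keplerian orbit.** Fix $a>0$ and $e\in[0,1)$. For $t\in\mathbb R$ let $u=u(t)$ be the unique solution of Kepler's equation $t=u-e\sin u$. Define $r(t;e)=a(1-e\cos u)$ and let $f(t;e)$ be the continuous function of $t$ with $f(0;e)=0$ and $r\exp(if)=a(\cos u-e+i\sqrt{1-e^2}\,\sin u)$. **Parameters.** For $j=1,2$, the ellipsoid $\mathcal E_j$ has mass $M_j>0$ and principal moments of inertia $\mathcal A_j\le\mathcal B_j\le\mathcal C_j$, with units such that $M_1+M_2=1$, $\mathcal C_1+\mathcal C_2=1$ and orbital period $2\pi$. Put $\mu=M_1M_2$, $d_j=\mathcal B_j-\mathcal A_j$, $q_j=2\mathcal C_j-\mathcal B_j-\mathcal A_j$, and $$\lambda_j=3\frac{\mu}{M_j}\frac{d_j}{\mathcal C_j},\qquad \sigma_j=\frac13\frac{\mathcal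 C_j}{\mu a^2},\qquad \hat q_j=\frac{q_j}{M_ja^2}.$$ These are real constants in the equations. **Reversing symmetries and symmetric orbits.** Each equation is written as an autonomous system $\dot{\mathbf x}=\mathbf F(\mathbf x)$ for $\mathbf x=(t,\theta,\dot\theta)\in\mathbb R^3$, with $\mathbf F(\mathbf x)=(1,\dot\theta,\ddot\theta)$ where $\ddot\theta$ is expressed through the equation. For $(\alpha,\beta)\in\pi\mathbb Z\times\frac{\pi}{2}\mathbb Z$ let $$R_{\alpha,\beta}(t,\theta,\dot\theta)=(2\alpha-t,\,2\beta-\theta,\,\dot\theta).$$ The orbit of $\mathbf x_0$ is $o(\mathbf x_0)=\{\mathbf x(s;\mathbf x_0): s\in\mathbb R\}$, where $\mathbf x(s;\mathbf x_0)$ is the solution with $\mathbf x(0;\mathbf x_0)=\mathbf x_0$. It is called $R$-symmetric if $R(o(\mathbf x_0))=o(\mathbf x_0)$. **Resonances.** A solution $\theta$ is in a standard $m:n$ spin-orbit resonance ($m\in\mathbb Z$, $n\in\mathbb Z\setminus\{0\}$) if $\theta(t+2\pi n)=\theta(t)+2\pi m$ for all $t$. It is in a balanced $m:2$ spin-orbit resonance ($m\in\mathbb Z$) if $\theta(t+2\pi)=\theta(t)+m\pi$ for all $t$. **Identifications.** The vector field $\mathbf F$ is $2\pi$-periodic in $t$ and $\pi$-periodic in $\theta$ (the mirror symmetries of the ellipsoid make the angle $\theta$ equivalent to $\theta+k\pi$, $k\in\mathbb Z$). Accordingly, two solutions are identified (equivalent) if one is obtained from the other by $\theta(t)\mapsto\theta(t+2\pi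 l)+k\pi$ with $k,l\in\mathbb Z$. *)

(* Defs.v *)
(* Stdlib's real numbers, with Coquelicot for derivatives, continuity and
   complex numbers. *)
From Stdlib Require Export Reals ZArith.
From Coquelicot Require Export Coquelicot.
Open Scope R_scope.

(** * Keplerian orbit *)

(* For 0 <= e < 1 this determines u. *)
Definition solves_kepler (e : R) (u : R -> R) : Prop :=
  forall t, t = u t - e * sin (u t).

Definition radius (a e : R) (u : R -> R) (t : R) : R :=
  a * (1 - e * cos (u t)).

(* exp (i x), as a pair (real part, imaginary part) *)
Definition cexp_i (x : R) : C := (cos x, sin x).

(* For a > 0, 0 <= e < 1 and u as above this determines f. *)
Definition true_anomaly (a e : R) (u f : R -> R) : Prop :=
  (forall t, continuous f t) /\
  f 0 = 0 /\
  forall t, (RtoC (radius a e u t) * cexp_i (f t))%C =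
            (RtoC a * (cos (u t) - e, sqrt (1 - e ^ 2) * sin (u t))%R)%C.

(** * Parameters *)

Record ellipsoid : Type := Ellipsoid {
  mass : R;
  momA : R;
  momB : R;
  momC : R
}.

Definition admissible (E : ellipsoid) : Prop :=
  0 < mass E /\ momA E <= momB E /\ momB E <= momC E /\ 0 < momC E.

Definition mom_d (E : ellipsoid) : R := momB E - momA E.
Definition mom_q (E : ellipsoid) : R := 2 * momC E - momB E - momA E.

(* Below, mu stands for the product of both masses. *)
Definition lambda (mu : R) (E : ellipsoid) : R :=
  3 * (mu / mass E) * (mom_d E / momC E).
Definition sigma (mu a : R) (E : ellipsoid) : R :=
  1 / 3 * (momC E / (mu * a ^ 2)).
Definition qhat (a : R) (E : ellipsoid) : R := mom_q E / (mass E * a ^ 2).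

(** * The equations theta'' + g (t, theta) = 0 *)

Definition spin_orbit (a lam : R) (r f : R -> R) (t th : R) : R :=
  lam / 2 * ((a / r t) ^ 3 * sin (2 * th - 2 * f t)).

Definition spin_with_sphere (a lam sig q : R) (r f : R -> R) (t th : R) : R :=
  lam / 2 *
    ((a / r t) ^ 3 * sin (2 * th - 2 * f t) +
     (a / r t) ^ 5 *
       (25 * q / 28 * sin (2 * th - 2 * f t) +
        25 * lam * sig / 8 * sin (4 * th - 4 * f t))).

Inductive equation : Type := SpinOrbit1 | SpinOrbit2 | SpinWithSphere.

Definition eq_term (E1 E2 : ellipsoid) (a : R) (r f : R -> R) (eqn : equation) :
    R -> R -> R :=
  let mu := mass E1 * mass E2 in
  match eqn with
  | SpinOrbit1 => spin_orbit a (lambda mu E1) r f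
  | SpinOrbit2 => spin_orbit a (lambda mu E2) r f
  | SpinWithSphere =>
      spin_with_sphere a (lambda mu E1) (sigma mu a E1) (qhat a E1) r f
  end.

Definition is_solution (g : R -> R -> R) (theta : R -> R) : Prop :=
  forall t, ex_derive theta t /\ ex_derive (Derive theta) t /\
            Derive (Derive theta) t + g t (theta t) = 0.

(** * Orbits and reversing symmetries *)

(* (t, theta, theta') *)
Definition state : Type := (R * R * R)%type.

Definition vector_field (g : R -> R -> R) (x : state) : state :=
  let '(t, th, om) := x in (1, om, - g t th).

Definition is_trajectory (g : R -> R -> R) (X : R -> state) : Prop :=
  forall s,
    is_derive (fun s => fst (fst (X s))) s (fst (fst (vector_field g (X s)))) /\
    is_derive (fun s => snd (fst (X s))) s (snd (fst (vector_field g (X s)))) /\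
    is_derive (fun s => snd (X s)) s (snd (vector_field g (X s))).

(* The point x lies on o(x0).  The vector fields considered are continuous,
   bounded in the direction of theta' and globally Lipschitz in (theta, theta'),
   so there is exactly one trajectory X with X 0 = x0. *)
Definition orbit (g : R -> R -> R) (x0 x : state) : Prop :=
  exists X : R -> state,
    is_trajectory g X /\ X 0 = x0 /\ exists s : R, x = X s.

Definition reversal (al be : R) (x : state) : state :=
  let '(t, th, om) := x in (2 * al - t, 2 * be - th, om).

Definition symmetric_orbit (g : R -> R -> R) (al be : R) (x0 : state) : Prop :=
  forall y, (exists x, orbit g x0 x /\ y = reversal al be x) <-> orbit g x0 y.

(* The orbit of a solution theta of the second-order equation is the orbit of
   this state. *)
Definition initial_state (theta : R -> R) : state :=
  (0, theta 0, Derive theta 0).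

(* R_{alpha,beta}-symmetry for some alpha in pi Z and beta in (pi/2) Z *)
Definition has_symmetric_orbit (g : R -> R -> R) (theta : R -> R) : Prop :=
  exists i j : Z,
    symmetric_orbit g (IZR i * PI) (IZR j * (PI / 2)) (initial_state theta).

(** * Resonances and identifications *)

Definition standard_resonance (m n : Z) (theta : R -> R) : Prop :=
  forall t, theta (t + 2 * PI * IZR n) = theta t + 2 * PI * IZR m.

Definition balanced_resonance (m : Z) (theta : R -> R) : Prop :=
  forall t, theta (t + 2 * PI) = theta t + IZR m * PI.

Definition identified (theta1 theta2 : R -> R) : Prop :=
  exists k l : Z,
    forall t, theta2 t = theta1 (t + 2 * PI * IZR l) + IZR k * PI.

(** * Boundary conditions *)

Definition dirichlet (al be : R) (m n : Z) (theta : R -> R) : Prop :=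
  theta al = be /\ theta (al + IZR n * PI) = be + IZR m * PI.

Definition type_zero (m : Z) (theta : R -> R) : Prop :=
  theta 0 = 0 /\ theta PI = IZR m * PI / 2.

Definition type_half_pi (m : Z) (theta : R -> R) : Prop :=
  theta 0 = PI / 2 /\ theta PI = (IZR m + 1) * PI / 2.

(* Main.v *)
(** The parity and the 2 pi-periodicity of the Keplerian orbit make the vector
    field of each equation invariant under the translations
    (2 pi l, k pi) of (t, theta) and equivariant under the point reflections
    in (i pi, j pi / 2).  As solutions are unique (the force is Lipschitz in
    theta), a solution is symmetric under the reflection in such a point if and
    only if its graph passes through it.  Two reflections compose to a
    translation by twice the vector between their centres, so that a symmetric
    solution is resonant if and only if its graph passes through a second
    centre.  The identifications bring the first centre to one of the listed
    positions. *)

From Stdlib Require Import Lra Lia.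
Require Import Defs.

(** * Uniqueness of solutions *)

(** Gronwall's argument: [E s * exp (- k * s)] has derivative [(dE s - k * E s) * exp (- k * s)],
    which is at most 0. It starts at 0 and is never negative, so it stays 0. *)
Lemma nonneg_increasing_zero (E dE : R -> R) (k t0 : R) :
  (forall t, is_derive E t (dE t)) -> (forall t, 0 <= E t) ->
  (forall t, dE t <= k * E t) -> E t0 = 0 ->
  forall t, t0 <= t -> E t = 0.
Proof.
  intros HE Hpos Hle H0 t Ht.
  destruct (MVT_gen (fun s => E s * exp (- k * s)) t0 t
              (fun s => (dE s - k * E s) * exp (- k * s))) as [c [_ Hc]].
  - intros s _. evar_last.
    + apply (is_derive_mult E (fun s => exp (- k * s)) s (dE s)
               (- k * exp (- k * s))).
      * apply HE.
      * auto_derive; [exact I | ring].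
      * intros; apply Rmult_comm.
    + unfold plus, mult; simpl; ring.
  - intros s _. apply continuity_pt_mult.
    + apply derivable_continuous_pt. exists (dE s). apply is_derive_Reals, HE.
    + apply continuity_pt_filterlim.
      apply (ex_derive_continuous (fun s => exp (- k * s))). now auto_derive.
  - cbv beta in Hc. rewrite H0 in Hc.
    assert (Hexp : 0 < exp (- k * t)) by apply exp_pos.
    assert (Hexp' : 0 < exp (- k * c)) by apply exp_pos.
    specialize (Hle c). specialize (Hpos t).
    assert (0 <= (k * E c - dE c) * exp (- k * c) * (t - t0))
      by (apply Rmult_le_pos; [apply Rmult_le_pos|]; lra).
    nra.
Qed.

(** The energy [w^2 + v^2] vanishes at [t0] and its derivative is bounded by a multiple of itself in
    absolute value, so that Gronwall applies both forwards and backwards in time. *)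
Lemma second_order_gronwall (w v z : R -> R) (L t0 : R) :
  (forall t, is_derive w t (v t)) -> (forall t, is_derive v t (z t)) ->
  (forall t, Rabs (z t) <= L * Rabs (w t)) -> w t0 = 0 -> v t0 = 0 ->
  forall t, w t = 0 /\ v t = 0.
Proof.
  intros Hw Hv Hz Hw0 Hv0.
  set (E := fun t => w t * w t + v t * v t).
  set (dE := fun t => 2 * w t * v t + 2 * v t * z t).
  assert (HE : forall t, is_derive E t (dE t)).
  { intros t. unfold E, dE. evar_last.
    - apply (is_derive_plus (fun t => w t * w t) (fun t => v t * v t)).
      + apply (is_derive_mult w w t _ _ (Hw t) (Hw t)).
        intros; apply Rmult_comm.
      + apply (is_derive_mult v v t _ _ (Hv t) (Hv t)).
        intros; apply Rmult_comm.
    - unfold plus, mult; simpl; ring. }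
  assert (Hpos : forall t, 0 <= E t) by (intros t; unfold E; nra).
  (* As [2|wv| <= E], the term [2wv] contributes the 1 and the term [2vz] contributes [|L|]. The
     absolute value is taken because the sign of L is not fixed. *)
  assert (Hbound : forall t, Rabs (dE t) <= (1 + Rabs L) * E t).
  { intros t. unfold dE, E.
    assert (Hz' : Rabs (z t) <= Rabs L * Rabs (w t)).
    { eapply Rle_trans; [apply Hz |].
      apply Rmult_le_compat_r; [apply Rabs_pos | apply Rle_abs]. }
    assert (Hwv : 2 * (Rabs (w t) * Rabs (v t)) <= w t * w t + v t * v t).
    { rewrite <- (Rabs_right (w t * w t)), <- (Rabs_right (v t * v t)) by nra.
      rewrite !Rabs_mult.
      assert (Hsq := Rle_0_sqr (Rabs (w t) - Rabs (v t))). unfold Rsqr in Hsq.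
      lra. }
    eapply Rle_trans; [apply Rabs_triang |].
    rewrite !Rabs_mult, (Rabs_right 2) by lra.
    assert (Rabs (v t) * Rabs (z t) <= Rabs (v t) * (Rabs L * Rabs (w t)))
      by (apply Rmult_le_compat_l; [apply Rabs_pos | exact Hz']).
    assert (HL := Rabs_pos L). nra. }
  assert (H0 : E t0 = 0) by (unfold E; rewrite Hw0, Hv0; ring).
  assert (Hzero : forall t, E t = 0).
  { intros t. destruct (Rle_dec t0 t) as [Ht | Ht].
    - apply (nonneg_increasing_zero E dE (1 + Rabs L) t0); trivial.
      intros s. eapply Rle_trans; [apply Rle_abs | apply Hbound].
    (* Times before [t0] are reached by reversing time. *)
    - rewrite <- (Ropp_involutive t).
      apply (nonneg_increasing_zero (fun s => E (- s)) (fun s => - dE (- s))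
               (1 + Rabs L) (- t0)); [| | | now rewrite Ropp_involutive | lra].
      + intros s. evar_last.
        * apply (is_derive_comp E Ropp s (dE (- s)) (-1)); [apply HE |].
          auto_derive; [exact I | ring].
        * unfold scal; simpl; unfold mult; simpl; ring.
      + intros s; apply Hpos.
      + intros s. eapply Rle_trans; [| apply Hbound].
        rewrite <- Rabs_Ropp. apply Rle_abs. }
  intros t. specialize (Hzero t). unfold E in Hzero. split; nra.
Qed.

(** First-order form with the velocity as a separate function: translated and reflected solutions,
    and the components of a trajectory, come with an explicit velocity. *)
Definition is_motion (g : R -> R -> R) (th om : R -> R) : Prop :=
  forall t : R, is_derive th t (om t) /\ is_derive om t (- g t (th t)).

Lemma solution_motion g th : is_solution g th -> is_motion g th (Derive th).
Proof.
  intros H t. destruct (H t) as [H1 [H2 H3]]. split.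
  - now apply Derive_correct.
  - replace (- g t (th t)) with (Derive (Derive th) t) by lra.
    now apply Derive_correct.
Qed.

Lemma motion_solution g th om : is_motion g th om -> is_solution g th.
Proof.
  intros H t.
  assert (Hom : forall s, om s = Derive th s)
    by (intros s; symmetry; apply is_derive_unique, H).
  destruct (H t) as [H1 H2].
  apply (is_derive_ext _ _ _ _ Hom) in H2.
  split; [|split].
  - now exists (om t).
  - now exists (- g t (th t)).
  - rewrite (is_derive_unique _ _ _ H2). ring.
Qed.

Definition lipschitz_force (g : R -> R -> R) : Prop :=
  exists L, forall t x y, Rabs (g t x - g t y) <= L * Rabs (x - y).

Lemma motion_unique g th1 om1 th2 om2 t0 :
  lipschitz_force g -> is_motion g th1 om1 -> is_motion g th2 om2 ->
  th1 t0 = th2 t0 -> om1 t0 = om2 t0 ->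
  forall t, th1 t = th2 t /\ om1 t = om2 t.
Proof.
  intros [L HL] H1 H2 Hth Hom t.
  destruct (second_order_gronwall (fun s => th1 s - th2 s)
    (fun s => om1 s - om2 s)
    (fun s => - g s (th1 s) - - g s (th2 s)) L t0) with (t := t) as [A B].
  - intros s. apply (is_derive_minus th1 th2); [apply H1 | apply H2].
  - intros s. apply (is_derive_minus om1 om2); [apply H1 | apply H2].
  - intros s. rewrite <- Rabs_Ropp.
    replace (- (- g s (th1 s) - - g s (th2 s)))
      with (g s (th1 s) - g s (th2 s)) by ring.
    apply HL.
  - lra.
  - lra.
  - lra.
Qed.

(** * Orbits and their reflections *)

(** With [c = d = 1] this differentiates translates, with [c = d = -1] point reflections, and with
    [c = 1], [d = -1] the velocity of a reflected solution. *)
Lemma is_derive_affine (h : R -> R) (p b c d t l : R) :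
  is_derive h (p + d * t) l ->
  is_derive (fun s => b + c * h (p + d * s)) t (c * (d * l)).
Proof.
  intros H. evar_last.
  - apply (is_derive_plus (fun _ => b) (fun s => c * h (p + d * s))).
    + apply is_derive_const.
    + apply is_derive_scal.
      apply (is_derive_comp h (fun s => p + d * s)); [exact H |].
      auto_derive; [exact I | reflexivity].
  - unfold plus, zero, scal; simpl; unfold mult; simpl; ring.
Qed.

(** The time coordinate of a trajectory has derivative 1 and starts at 0, so it equals the
    parameter. The other two coordinates then form a motion with the initial data of [th], and
    uniqueness applies. *)
Lemma orbit_graph g th : lipschitz_force g -> is_solution g th ->
  forall y, orbit g (initial_state th) y <->
            exists s, y = (s, th s, Derive th s).
Proof.
  intros HL Hth y. split.
  - intros [X [HX [H0 [s ->]]]]. exists s.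
    assert (Htime : forall r, fst (fst (X r)) = r).
    { intros r.
      destruct (MVT_gen (fun s => fst (fst (X s)) - s) 0 r (fun _ => 0))
        as [c [_ Hc]].
      - intros q _. destruct (HX q) as [Hq _].
        evar_last.
        + apply (is_derive_minus (fun s => fst (fst (X s))) (fun s => s)).
          * exact Hq.
          * apply (@is_derive_id R_AbsRing).
        + destruct (X q) as [[? ?] ?]. unfold minus, plus, opp, one; simpl.
          ring.
      - intros q _. destruct (HX q) as [Hq _].
        apply continuity_pt_minus.
        + apply derivable_continuous_pt. eexists. apply is_derive_Reals, Hq.
        + apply continuity_pt_id.
      - rewrite H0 in Hc. simpl in Hc. lra. }
    assert (HM : is_motion g (fun s => snd (fst (X s))) (fun s => snd (X s))).
    { intros r. destruct (HX r) as [_ [H1 H2]]. specialize (Htime r).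
      destruct (X r) as [[? ?] ?]. simpl in *. subst. now split. }
    destruct (motion_unique g _ _ _ _ 0 HL HM (solution_motion g th Hth))
      with (t := s) as [A B]; try (rewrite H0; reflexivity).
    specialize (Htime s).
    destruct (X s) as [[? ?] ?]. simpl in *. now subst.
  - intros [s ->]. exists (fun s => (s, th s, Derive th s)).
    split; [|split; [reflexivity | now exists s]].
    intros r. simpl. destruct (solution_motion g th Hth r).
    split; [|split]; trivial. apply (@is_derive_id R_AbsRing).
Qed.

(** * Point symmetry of the graph of a solution *)

Definition reflects (th : R -> R) (al be : R) : Prop :=
  forall t, th (2 * al - t) = 2 * be - th t.

Lemma reflects_derive g th al be : is_solution g th -> reflects th al be ->
  forall t, Derive th (2 * al - t) = Derive th t.
Proof.
  intros Hth Hr t.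
  symmetry. apply is_derive_unique.
  apply (is_derive_ext (fun s => 2 * be + (-1) * th (2 * al + (-1) * s))).
  - intros s. replace (2 * al + -1 * s) with (2 * al - s) by ring.
    rewrite Hr. simpl; ring.
  - replace (Derive th (2 * al - t))
      with (-1 * (-1 * Derive th (2 * al + -1 * t)))
      by (replace (2 * al + -1 * t) with (2 * al - t) by ring; ring).
    apply is_derive_affine, (solution_motion g th Hth).
Qed.

(** The reversal sends the point of the orbit at time t to a point at time [2 * al - t]. Comparing
    angles gives one direction; for the other, [reflects_derive] makes the velocities agree as
    well. *)
Lemma symmetric_orbit_reflects g th al be :
  lipschitz_force g -> is_solution g th ->
  (symmetric_orbit g al be (initial_state th) <-> reflects th al be).
Proof.
  intros HL Hth. assert (HO := orbit_graph g th HL Hth). split.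
  - intros H t.
    destruct (proj1 (HO (reversal al be (t, th t, Derive th t)))) as [s Hs].
    + apply H. exists (t, th t, Derive th t). split; trivial.
      apply HO. now exists t.
    + simpl in Hs. injection Hs as H1 H2 H3. now rewrite H1.
  - intros Hr y. assert (Hd := reflects_derive g th al be Hth Hr).
    rewrite HO. split.
    + intros [x [Hx ->]]. apply HO in Hx. destruct Hx as [s ->].
      exists (2 * al - s). simpl. now rewrite Hr, Hd.
    + intros [s ->].
      exists (2 * al - s, th (2 * al - s), Derive th (2 * al - s)). split.
      * apply HO. now exists (2 * al - s).
      * simpl. rewrite Hr, Hd.
        do 2 f_equal; ring.
Qed.

Lemma reflects_center th al be : reflects th al be -> th al = be.
Proof.
  intros H. specialize (H al). replace (2 * al - al) with al in H by ring. lra.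
Qed.

Lemma reflects_twice th al be A B :
  reflects th al be -> reflects th (al + A) (be + B) ->
  forall t, th (t + 2 * A) = th t + 2 * B.
Proof.
  intros H1 H2 t.
  replace (t + 2 * A) with (2 * (al + A) - (2 * al - t)) by ring.
  rewrite H2, H1. ring.
Qed.

(** Composing a point reflection with a translation moves its centre by half the translation
    vector. *)
Lemma reflects_translate th al be A B :
  reflects th al be -> (forall t, th (t + 2 * A) = th t + 2 * B) ->
  reflects th (al + A) (be + B).
Proof.
  intros H1 H2 t.
  replace (2 * (al + A) - t) with (2 * al - t + 2 * A) by ring.
  rewrite H2, H1. ring.
Qed.

Lemma translate_iter th A B : (forall t, th (t + A) = th t + B) ->
  forall (k : Z) t, th (t + IZR k * A) = th t + IZR k * B.
Proof.
  intros H.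
  assert (HN : forall (k : nat) t, th (t + INR k * A) = th t + INR k * B).
  { induction k as [|k IH]; intros t.
    - simpl. rewrite !Rmult_0_l, !Rplus_0_r. reflexivity.
    - rewrite S_INR. replace (t + (INR k + 1) * A) with (t + INR k * A + A)
        by ring.
      rewrite H, IH. ring. }
  intros k t. destruct (Z_le_dec 0 k) as [Hk | Hk].
  - replace k with (Z.of_nat (Z.to_nat k)) by lia.
    rewrite <- INR_IZR_INZ. apply HN.
  - replace k with (- Z.of_nat (Z.to_nat (- k)))%Z by lia.
    rewrite opp_IZR, <- INR_IZR_INZ.
    (* A negative multiple is the nonnegative case read from the starting point [t - n * A]. *)
    set (n := Z.to_nat (- k)). specialize (HN n (t + - INR n * A)).
    replace (t + - INR n * A + INR n * A) with t in HN by ring. lra.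
Qed.

(** * Symmetries of the equations *)

Definition translation_invariant (g : R -> R -> R) : Prop :=
  forall (l k : Z) t x,
    g (t + 2 * PI * IZR l) (x + IZR k * PI) = g t x.

(** A half-turn about a centre reverses the sign of the acceleration, hence the minus sign. *)
Definition reflection_equivariant (g : R -> R -> R) : Prop :=
  forall (i j : Z) t x,
    g (2 * (IZR i * PI) - t) (2 * (IZR j * (PI / 2)) - x) = - g t x.

Lemma solution_translate g th (k l : Z) :
  translation_invariant g -> is_solution g th ->
  is_solution g (fun t => th (t + 2 * PI * IZR l) + IZR k * PI).
Proof.
  intros Hg Hth.
  apply motion_solution with (fun t => Derive th (t + 2 * PI * IZR l)).
  intros t.
  destruct (solution_motion g th Hth (2 * PI * IZR l + 1 * t)) as [H1 H2].
  split.
  - apply (is_derive_ext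
      (fun s => IZR k * PI + 1 * th (2 * PI * IZR l + 1 * s))).
    + intros s. replace (2 * PI * IZR l + 1 * s) with (s + 2 * PI * IZR l)
        by ring. simpl; ring.
    + replace (t + 2 * PI * IZR l) with (2 * PI * IZR l + 1 * t) by ring.
      evar_last; [apply is_derive_affine, H1 | ring].
  - apply (is_derive_ext
      (fun s => 0 + 1 * Derive th (2 * PI * IZR l + 1 * s))).
    + intros s. replace (2 * PI * IZR l + 1 * s) with (s + 2 * PI * IZR l)
        by ring. simpl; ring.
    + evar_last; [apply is_derive_affine, H2 |].
      rewrite <- (Hg l k t), Hg.
      replace (2 * PI * IZR l + 1 * t) with (t + 2 * PI * IZR l) by ring.
      (* The angle is shifted at fixed time, then the time at fixed angle. *)
      rewrite <- (Hg 0%Z k (t + 2 * PI * IZR l)).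
      rewrite Rmult_0_r, Rplus_0_r.
      rewrite <- (Hg l 0%Z t), Rmult_0_l, Rplus_0_r. ring.
Qed.

(** By equivariance the reflected curve [2 * be - th (2 * al - t)], with velocity
    [Derive th (2 * al - t)], is again a motion. At [t = al] the velocities agree, and the positions
    agree because [th al = be]; uniqueness makes the two curves equal. *)
Lemma solution_reflects g th (i j : Z) al be :
  lipschitz_force g -> reflection_equivariant g -> is_solution g th ->
  al = IZR i * PI -> be = IZR j * (PI / 2) -> th al = be ->
  reflects th al be.
Proof.
  intros HL Hg Hth -> -> H0.
  set (al := IZR i * PI) in *. set (be := IZR j * (PI / 2)) in *.
  assert (HM : is_motion g (fun t => 2 * be + (-1) * th (2 * al + (-1) * t))
                 (fun t => 0 + 1 * Derive th (2 * al + (-1) * t))).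
  { intros t.
    destruct (solution_motion g th Hth (2 * al + -1 * t)) as [H1 H2]. split.
    - evar_last; [apply is_derive_affine, H1 | ring].
    - evar_last; [apply is_derive_affine, H2 |].
      replace (2 * be + -1 * th (2 * al + -1 * t))
        with (2 * be - th (2 * al + -1 * t)) by ring.
      assert (H := Hg i j (2 * al + -1 * t) (th (2 * al + -1 * t))).
      fold al be in H.
      replace (2 * al - (2 * al + -1 * t)) with t in H by ring.
      rewrite H. ring. }
  intros t.
  destruct (motion_unique g _ _ _ _ al HL (solution_motion g th Hth) HM)
    with (t := t) as [Ht _].
  - replace (2 * al + -1 * al) with al by ring. lra.
  - replace (2 * al + -1 * al) with al by ring. ring.
  - replace (2 * al - t) with (2 * al + -1 * t) by ring. lra.
Qed.

(** * Transport of symmetry and periodicity along identifications *)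

Lemma identified_sym th1 th2 : identified th1 th2 -> identified th2 th1.
Proof.
  intros [k [l H]]. exists (- k)%Z, (- l)%Z. intros t.
  rewrite H, !opp_IZR.
  replace (t + 2 * PI * - IZR l + 2 * PI * IZR l) with t by ring. ring.
Qed.

Lemma identified_translation th1 th2 A B : identified th1 th2 ->
  (forall t, th1 (t + A) = th1 t + B) -> forall t, th2 (t + A) = th2 t + B.
Proof.
  intros [k [l H]] H1 t. rewrite !H.
  replace (t + A + 2 * PI * IZR l) with (t + 2 * PI * IZR l + A) by ring.
  rewrite H1. ring.
Qed.

(** The graph of [th2] is that of [th1] moved by [(-2 pi l, k pi)], and the centre moves along. *)
Lemma identified_reflects th1 th2 al be (k l : Z) :
  (forall t, th2 t = th1 (t + 2 * PI * IZR l) + IZR k * PI) ->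
  reflects th1 al be ->
  reflects th2 (al - IZR l * (2 * PI)) (be + IZR k * PI).
Proof.
  intros H Hr t. rewrite !H.
  replace (2 * (al - IZR l * (2 * PI)) - t + 2 * PI * IZR l)
    with (2 * al - (t + 2 * PI * IZR l)) by ring.
  rewrite Hr. ring.
Qed.

Lemma has_symmetric_orbit_reflects g th :
  lipschitz_force g -> is_solution g th ->
  (has_symmetric_orbit g th <->
   exists i j : Z, reflects th (IZR i * PI) (IZR j * (PI / 2))).
Proof.
  intros HL Hth. split; intros [i [j H]]; exists i, j;
    now apply symmetric_orbit_reflects in H || apply symmetric_orbit_reflects.
Qed.

Lemma has_symmetric_orbit_identified g th1 th2 :
  lipschitz_force g -> is_solution g th1 -> is_solution g th2 ->
  identified th1 th2 -> has_symmetric_orbit g th1 -> has_symmetric_orbit g th2.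
Proof.
  intros HL H1 H2 [k [l H]].
  rewrite !has_symmetric_orbit_reflects by assumption.
  intros [i [j Hr]]. exists (i - 2 * l)%Z, (j + 2 * k)%Z.
  rewrite minus_IZR, plus_IZR, !mult_IZR.
  replace ((IZR i - 2 * IZR l) * PI) with (IZR i * PI - IZR l * (2 * PI))
    by ring.
  replace ((IZR j + 2 * IZR k) * (PI / 2)) with (IZR j * (PI / 2) + IZR k * PI)
    by field.
  now apply (identified_reflects th1).
Qed.

Lemma Z_even_or_odd (z : Z) : exists p : Z, z = (2 * p)%Z \/ z = (2 * p + 1)%Z.
Proof. destruct (Z.Even_or_Odd z) as [[p H] | [p H]]; exists p; auto. Qed.

(** * Resonant symmetric solutions of an equation with these symmetries *)

Section Resonances.
Variable g : R -> R -> R.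
Hypothesis HL : lipschitz_force g.
Hypothesis HT : translation_invariant g.
Hypothesis HR : reflection_equivariant g.

(** Both boundary points lie in the lattice of centres: if the first has indices [(i, j)], the
    second has [(i + n, j + 2 * m)]. *)
Lemma dirichlet_reflects (m n : Z) th al be :
  is_solution g th -> (al = 0 \/ al = PI) -> (be = 0 \/ be = PI / 2) ->
  dirichlet al be m n th ->
  reflects th al be /\ reflects th (al + IZR n * PI) (be + IZR m * PI).
Proof.
  intros Hth Hal Hbe [D1 D2].
  assert (Hi : exists i, al = IZR i * PI)
    by (destruct Hal; [exists 0%Z | exists 1%Z]; lra).
  assert (Hj : exists j, be = IZR j * (PI / 2))
    by (destruct Hbe; [exists 0%Z | exists 1%Z]; lra).
  destruct Hi as [i Hi], Hj as [j Hj]. split.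
  - now apply (solution_reflects g th i j).
  - apply (solution_reflects g th (i + n) (j + 2 * m)); trivial;
      rewrite plus_IZR, ?mult_IZR; lra.
Qed.

(** The two boundary points differ by [(n pi, m pi)], half the period vector of the resonance. Hence
    one centre and the resonance give the other centre, and two centres give the resonance. *)
Lemma symmetric_standard_dirichlet (m n : Z) th al be :
  is_solution g th -> (al = 0 \/ al = PI) -> (be = 0 \/ be = PI / 2) ->
  (symmetric_orbit g al be (initial_state th) /\ standard_resonance m n th <->
   dirichlet al be m n th).
Proof.
  intros Hth Hal Hbe. rewrite symmetric_orbit_reflects by assumption. split.
  - intros [Hr Hs]. split; apply reflects_center; trivial.
    apply reflects_translate; trivial. intros t.
    replace (2 * (IZR n * PI)) with (2 * PI * IZR n) by ring.
    rewrite Hs. ring.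
  - intros HD.
    destruct (dirichlet_reflects m n th al be Hth Hal Hbe HD) as [H1 H2].
    split; trivial. intros t.
    replace (2 * PI * IZR n) with (2 * (IZR n * PI)) by ring.
    rewrite (reflects_twice _ _ _ _ _ H1 H2). ring.
Qed.

Lemma standard_resonance_characterization (m n : Z) th : is_solution g th ->
  (has_symmetric_orbit g th /\ standard_resonance m n th <->
   exists (th' : R -> R) (al be : R),
     is_solution g th' /\ identified th th' /\
     (al = 0 \/ al = PI) /\ (be = 0 \/ be = PI / 2) /\
     dirichlet al be m n th').
Proof.
  intros Hth. split.
  - intros [Hsym Hres].
    apply has_symmetric_orbit_reflects in Hsym; trivial.
    destruct Hsym as [i [j Hr]].
    (* Identifications change both indices of the centre by even numbers, so only their parities
       remain: four positions. *)
    destruct (Z_even_or_odd i) as [l Hi], (Z_even_or_odd j) as [k Hj].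
    set (th' := fun t => th (t + 2 * PI * IZR l) + IZR (- k) * PI).
    assert (Hth' : is_solution g th') by now apply solution_translate.
    assert (Hid : identified th th') by (exists (- k)%Z, l; reflexivity).
    assert (Hr' := identified_reflects th th' _ _ _ _ (fun t => eq_refl) Hr).
    exists th', (IZR i * PI - IZR l * (2 * PI)),
      (IZR j * (PI / 2) + IZR (- k) * PI).
    assert (Hal : IZR i * PI - IZR l * (2 * PI) = 0 \/
                  IZR i * PI - IZR l * (2 * PI) = PI).
    { destruct Hi as [-> | ->]; [left | right];
        rewrite ?plus_IZR, mult_IZR; ring. }
    assert (Hbe : IZR j * (PI / 2) + IZR (- k) * PI = 0 \/
                  IZR j * (PI / 2) + IZR (- k) * PI = PI / 2).
    { destruct Hj as [-> | ->]; [left | right];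
        rewrite ?plus_IZR, mult_IZR, opp_IZR; field. }
    do 4 (split; trivial).
    apply symmetric_standard_dirichlet; trivial. split.
    + now apply symmetric_orbit_reflects.
    + unfold standard_resonance. now apply (identified_translation th).
  - intros [th' [al [be [Hth' [Hid [Hal [Hbe HD]]]]]]].
    apply identified_sym in Hid.
    destruct (dirichlet_reflects m n th' al be Hth' Hal Hbe HD) as [H1 _].
    apply symmetric_standard_dirichlet in HD; trivial.
    destruct HD as [_ Hres]. split.
    + apply (has_symmetric_orbit_identified g th'); trivial.
      apply has_symmetric_orbit_reflects; trivial.
      destruct Hal as [-> | ->]; [exists 0%Z | exists 1%Z];
        (destruct Hbe as [-> | ->]; [exists 0%Z | exists 1%Z]);
        rewrite ?Rmult_0_l, ?Rmult_1_l; assumption.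
    + unfold standard_resonance. now apply (identified_translation th').
Qed.

(** * Balanced resonances and their two types *)

Lemma type_zero_reflects (m : Z) th : is_solution g th -> type_zero m th ->
  reflects th 0 0 /\ reflects th (0 + PI) (0 + IZR m * (PI / 2)).
Proof.
  intros Hth [H1 H2]. rewrite !Rplus_0_l. split.
  - apply (solution_reflects g th 0 0); trivial; ring.
  - apply (solution_reflects g th 1 m); trivial; [ring | rewrite H2; field].
Qed.

Lemma type_half_pi_reflects (m : Z) th : is_solution g th ->
  type_half_pi m th ->
  reflects th 0 (PI / 2) /\
  reflects th (0 + PI) (PI / 2 + IZR m * (PI / 2)).
Proof.
  intros Hth [H1 H2]. rewrite !Rplus_0_l. split.
  - apply (solution_reflects g th 0 1); trivial; ring.
  - apply (solution_reflects g th 1 (m + 1)); trivial.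
    + ring.
    + rewrite plus_IZR. field.
    + rewrite H2. field.
Qed.

Lemma reflects_balanced (m : Z) th be :
  reflects th 0 be -> reflects th (0 + PI) (be + IZR m * (PI / 2)) ->
  balanced_resonance m th.
Proof.
  intros H1 H2 t. rewrite (reflects_twice _ _ _ _ _ H1 H2). field.
Qed.

(** Half the period vector is [(pi, m pi / 2)], so centres recur at every multiple of pi in time and
    one of them lies at [t = 0]. Only the parity of its angle index is left, which gives two types
    instead of four. *)
Lemma balanced_resonance_characterization (m : Z) th : is_solution g th ->
  (has_symmetric_orbit g th /\ balanced_resonance m th <->
   exists th' : R -> R,
     is_solution g th' /\ identified th th' /\
     (type_zero m th' \/ type_half_pi m th')).
Proof.
  intros Hth. split.
  - intros [Hsym Hres].
    apply has_symmetric_orbit_reflects in Hsym; trivial.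
    destruct Hsym as [i [j Hr]].
    (* The resonance moves the centre of symmetry from t = i pi to t = 0. *)
    assert (Hr0 : reflects th 0 (IZR (j - i * m) * (PI / 2))).
    { replace 0 with (IZR i * PI + IZR (- i) * PI) by (rewrite opp_IZR; ring).
      replace (IZR (j - i * m) * (PI / 2))
        with (IZR j * (PI / 2) + IZR (- i) * (IZR m * PI / 2))
        by (rewrite minus_IZR, mult_IZR, opp_IZR; field).
      apply reflects_translate; trivial. intros t.
      replace (2 * (IZR (- i) * PI)) with (IZR (- i) * (2 * PI)) by ring.
      rewrite (translate_iter th (2 * PI) (IZR m * PI)) by exact Hres.
      field. }
    destruct (Z_even_or_odd (j - i * m)) as [k Hk].
    (* With the centre already at [t = 0], only the angle is normalised. *)
    set (th' := fun t => th (t + 2 * PI * IZR 0) + IZR (- k) * PI).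
    assert (Hid : identified th th') by (exists (- k)%Z, 0%Z; reflexivity).
    exists th'. split; [now apply solution_translate | split; trivial].
    assert (Hr' := identified_reflects th th' _ _ _ _ (fun t => eq_refl) Hr0).
    rewrite Rmult_0_l, Rminus_0_r in Hr'.
    assert (Hres' := identified_translation _ _ _ _ Hid Hres).
    assert (Hr'' : reflects th' (0 + PI)
      (IZR (j - i * m) * (PI / 2) + IZR (- k) * PI + IZR m * PI / 2)).
    { apply reflects_translate; trivial. intros t. rewrite Hres'. field. }
    rewrite Rplus_0_l in Hr''.
    apply reflects_center in Hr'. apply reflects_center in Hr''.
    destruct Hk as [Hk | Hk]; [left | right];
      (split; [rewrite Hr' | rewrite Hr'']);
      rewrite Hk, opp_IZR, ?plus_IZR, mult_IZR; field.
  - intros [th' [Hth' [Hid Htype]]]. apply identified_sym in Hid.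
    assert (H : exists j : Z, reflects th' 0 (IZR j * (PI / 2)) /\
                  balanced_resonance m th').
    { destruct Htype as [H | H].
      - apply type_zero_reflects in H; trivial. destruct H as [H1 H2].
        exists 0%Z. rewrite Rmult_0_l. split; trivial.
        now apply (reflects_balanced m th' 0).
      - apply type_half_pi_reflects in H; trivial. destruct H as [H1 H2].
        exists 1%Z. rewrite Rmult_1_l. split; trivial.
        now apply (reflects_balanced m th' (PI / 2)). }
    destruct H as [j [Hr Hres]]. split.
    + apply (has_symmetric_orbit_identified g th'); trivial.
      apply has_symmetric_orbit_reflects; trivial.
      exists 0%Z, j. now rewrite Rmult_0_l.
    + unfold balanced_resonance. now apply (identified_translation th').
Qed.

(** By its resonance, a solution of type 0 takes the value [l m pi] at [2 pi l]. Anything identified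
    with it is therefore a multiple of pi at 0, never [pi / 2]. *)
Lemma balanced_types_distinct (m : Z) th1 th2 :
  is_solution g th1 -> type_zero m th1 -> type_half_pi m th2 ->
  ~ identified th1 th2.
Proof.
  intros Hth H1 [H2 _] [k [l H]].
  destruct (type_zero_reflects m th1 Hth H1) as [Hr1 Hr2].
  assert (Hres := reflects_balanced m th1 0 Hr1 Hr2).
  specialize (H 0).
  replace (0 + 2 * PI * IZR l) with (0 + IZR l * (2 * PI)) in H by ring.
  rewrite (translate_iter th1 (2 * PI) (IZR m * PI)) in H by exact Hres.
  destruct H1 as [H1 _]. rewrite H1, H2 in H.
  assert (Hpi := PI_RGT_0).
  assert (Hz : IZR (2 * (l * m + k)) = 1).
  { rewrite mult_IZR, plus_IZR, mult_IZR.
    apply (Rmult_eq_reg_r (PI / 2)); lra. }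
  apply eq_IZR in Hz. lia.
Qed.

End Resonances.

(** * The equations have these symmetries *)

Lemma sin_cos_add_2kPI (k : Z) x :
  sin (x + 2 * (IZR k * PI)) = sin x /\ cos (x + 2 * (IZR k * PI)) = cos x.
Proof.
  assert (Hs : sin (IZR k * PI) = 0) by (apply sin_eq_0_1; now exists k).
  rewrite sin_plus, cos_plus, sin_2a, cos_2a_sin, Hs. split; ring.
Qed.

Lemma sin_cos_2kPI_sub (k : Z) x :
  sin (2 * (IZR k * PI) - x) = - sin x /\ cos (2 * (IZR k * PI) - x) = cos x.
Proof.
  rewrite <- sin_neg, <- (cos_neg x).
  replace (2 * (IZR k * PI) - x) with (- x + 2 * (IZR k * PI)) by ring.
  apply sin_cos_add_2kPI.
Qed.

Lemma sin_lipschitz x y : Rabs (sin x - sin y) <= Rabs (x - y).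
Proof.
  destruct (MVT_gen sin y x cos) as [c [_ Hc]].
  - intros t _. apply is_derive_sin.
  - intros t _. apply continuity_sin.
  - rewrite Hc, Rabs_mult. rewrite <- (Rmult_1_l (Rabs (x - y))) at 2.
    apply Rmult_le_compat_r; [apply Rabs_pos |].
    apply Rabs_le, COS_bound.
Qed.

(** Two solutions satisfy [x - y = e * (sin x - sin y)], and [e < 1] makes the right side a
    contraction. *)
Lemma kepler_injective e x y : 0 <= e < 1 ->
  x - e * sin x = y - e * sin y -> x = y.
Proof.
  intros He H. assert (Hs := sin_lipschitz x y).
  assert (Hxy : x - y = e * (sin x - sin y)) by lra.
  assert (Hle : Rabs (x - y) <= e * Rabs (x - y)).
  { rewrite Hxy at 1. rewrite Rabs_mult, (Rabs_right e) by lra.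
    apply Rmult_le_compat_l; lra. }
  destruct (Req_dec (x - y) 0) as [H0 | H0]; [lra |].
  apply Rabs_pos_lt in H0. nra.
Qed.

(** The sign s is 1 for translations and -1 for reflections, so one computation serves both. For x
    only the double angle is constrained, because [theta] matters modulo pi. *)
Lemma double_angle_difference (s x x' y y' : R) : s * s = 1 ->
  sin (2 * x') = s * sin (2 * x) -> cos (2 * x') = cos (2 * x) ->
  sin y' = s * sin y -> cos y' = cos y ->
  sin (2 * x' - 2 * y') = s * sin (2 * x - 2 * y) /\
  sin (4 * x' - 4 * y') = s * sin (4 * x - 4 * y).
Proof.
  intros Hs Hx1 Hx2 Hy1 Hy2.
  assert (H2s : sin (2 * y') = s * sin (2 * y))
    by (rewrite !sin_2a, Hy1, Hy2; ring).
  assert (H2c : cos (2 * y') = cos (2 * y)).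
  { rewrite !cos_2a_sin, Hy1.
    replace (2 * (s * sin y) * (s * sin y))
      with (s * s * (2 * sin y * sin y)) by ring.
    rewrite Hs. ring. }
  assert (Hsin : sin (2 * x' - 2 * y') = s * sin (2 * x - 2 * y))
    by (rewrite !sin_minus, Hx1, Hx2, H2s, H2c; ring).
  split; [exact Hsin |].
  assert (Hcos : cos (2 * x' - 2 * y') = cos (2 * x - 2 * y)).
  { rewrite !cos_minus, Hx1, Hx2, H2s, H2c.
    replace (s * sin (2 * x) * (s * sin (2 * y)))
      with (s * s * (sin (2 * x) * sin (2 * y))) by ring.
    rewrite Hs. ring. }
  replace (4 * x' - 4 * y') with (2 * (2 * x' - 2 * y')) by ring.
  replace (4 * x - 4 * y) with (2 * (2 * x - 2 * y)) by ring.
  rewrite sin_2a, Hsin, Hcos, sin_2a. ring.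
Qed.

Lemma lipschitz_force_scal (h : R -> R -> R) c :
  lipschitz_force h -> lipschitz_force (fun t x => c * h t x).
Proof.
  intros [L H]. exists (Rabs c * L). intros t x y.
  rewrite <- Rmult_minus_distr_l, Rabs_mult, Rmult_assoc.
  apply Rmult_le_compat_l; [apply Rabs_pos | apply H].
Qed.

Lemma lipschitz_force_plus (h1 h2 : R -> R -> R) :
  lipschitz_force h1 -> lipschitz_force h2 ->
  lipschitz_force (fun t x => h1 t x + h2 t x).
Proof.
  intros [L1 H1] [L2 H2]. exists (L1 + L2). intros t x y.
  replace (h1 t x + h2 t x - (h1 t y + h2 t y))
    with ((h1 t x - h1 t y) + (h2 t x - h2 t y)) by ring.
  eapply Rle_trans; [apply Rabs_triang |].
  rewrite Rmult_plus_distr_r. apply Rplus_le_compat; auto.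
Qed.

Lemma lipschitz_force_ext (h1 h2 : R -> R -> R) :
  (forall t x, h1 t x = h2 t x) -> lipschitz_force h1 -> lipschitz_force h2.
Proof.
  intros E [L H]. exists L. intros t x y. rewrite <- !E. apply H.
Qed.

(** * The force along a Keplerian orbit *)

Section Kepler.
Variables (E1 E2 : ellipsoid) (a e : R) (u f : R -> R) (eqn : equation).
Hypothesis Ha : 0 < a.
Hypothesis He : 0 <= e < 1.
Hypothesis Hu : solves_kepler e u.
Hypothesis Hf : true_anomaly a e u f.

Let r := radius a e u.
Let g := eq_term E1 E2 a r f eqn.

Lemma radius_lower_bound t : a * (1 - e) <= r t.
Proof.
  unfold r, radius. apply Rmult_le_compat_l; [lra |].
  assert (H := COS_bound (u t)). nra.
Qed.

Lemma radius_pos t : 0 < r t.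
Proof.
  eapply Rlt_le_trans; [| apply radius_lower_bound].
  apply Rmult_lt_0_compat; lra.
Qed.

Lemma true_anomaly_coordinates t :
  r t * cos (f t) = a * (cos (u t) - e) /\
  r t * sin (f t) = a * (sqrt (1 - e ^ 2) * sin (u t)).
Proof.
  destruct Hf as [_ [_ H]]. specialize (H t).
  unfold cexp_i, RtoC, Cmult in H; simpl in H.
  injection H as Hre Him. fold r in Hre, Him. simpl. split; lra.
Qed.

(** Dividing the orbital coordinates by the positive radius expresses the sine and cosine of [f]
    through those of [u]. *)
Lemma anomaly_transform (s t t' : R) :
  sin (u t') = s * sin (u t) -> cos (u t') = cos (u t) ->
  r t' = r t /\ sin (f t') = s * sin (f t) /\ cos (f t') = cos (f t).
Proof.
  intros H1 H2.
  assert (Hr : r t' = r t) by (unfold r, radius; now rewrite H2).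
  split; [exact Hr |].
  assert (Hpos := radius_pos t).
  destruct (true_anomaly_coordinates t) as [C S],
    (true_anomaly_coordinates t') as [C' S'].
  rewrite Hr, H2 in C'. rewrite Hr, H1 in S'.
  split; apply (Rmult_eq_reg_l (r t)); try lra.
  rewrite S'. replace (r t * (s * sin (f t))) with (s * (r t * sin (f t)))
    by ring.
  rewrite S. ring.
Qed.

Lemma force_transform (s t t' x x' : R) : s * s = 1 ->
  sin (u t') = s * sin (u t) -> cos (u t') = cos (u t) ->
  sin (2 * x') = s * sin (2 * x) -> cos (2 * x') = cos (2 * x) ->
  g t' x' = s * g t x.
Proof.
  intros Hs Hu1 Hu2 Hx1 Hx2.
  destruct (anomaly_transform s t t' Hu1 Hu2) as [Hr [Hf1 Hf2]].
  destruct (double_angle_difference s x x' (f t) (f t') Hs Hx1 Hx2 Hf1 Hf2)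
    as [D2 D4].
  unfold g. destruct eqn; simpl; unfold spin_orbit, spin_with_sphere;
    rewrite Hr, D2, ?D4; ring.
Qed.

Lemma force_translation_invariant : translation_invariant g.
Proof.
  intros l k t x. rewrite <- (Rmult_1_l (g t x)).
  (* Both sides solve Kepler's equation at the same time, because sin is [2 pi]-periodic. *)
  assert (Hshift : u (t + 2 * PI * IZR l) = u t + 2 * (IZR l * PI)).
  { apply (kepler_injective e); trivial. rewrite <- Hu.
    rewrite (proj1 (sin_cos_add_2kPI l (u t))).
    assert (H := Hu t). lra. }
  apply force_transform; rewrite ?Hshift, ?Rmult_1_l; trivial;
    rewrite ?Rmult_plus_distr_l; apply sin_cos_add_2kPI.
Qed.

Lemma force_reflection_equivariant : reflection_equivariant g.
Proof.
  intros i j t x.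
  (* The same argument, now also with the oddness of sin. *)
  assert (Hshift : u (2 * (IZR i * PI) - t) = 2 * (IZR i * PI) - u t).
  { apply (kepler_injective e); trivial. rewrite <- Hu.
    rewrite (proj1 (sin_cos_2kPI_sub i (u t))).
    assert (H := Hu t). lra. }
  rewrite <- (Rmult_1_l (g t x)), Ropp_mult_distr_l.
  apply force_transform; rewrite ?Hshift;
    (* Doubling the angle turns the reflection in [j pi / 2] into [2 j pi - 2 x], a sign change up
       to full turns; this is why half-integer multiples of pi are centres. *)
    try replace (2 * (2 * (IZR j * (PI / 2)) - x))
      with (2 * (IZR j * PI) - 2 * x) by field.
  - ring.
  - rewrite (proj1 (sin_cos_2kPI_sub i (u t))). ring.
  - apply sin_cos_2kPI_sub.
  - rewrite (proj1 (sin_cos_2kPI_sub j (2 * x))). ring.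
  - apply sin_cos_2kPI_sub.
Qed.

(** The bound [a / r <= 1 / (1 - e)], valid at all times, makes the constant uniform in t. *)
Lemma weighted_sin_lipschitz (n : nat) (k t x y : R) : 0 <= k ->
  Rabs ((a / r t) ^ n * sin (k * x - k * f t) -
        (a / r t) ^ n * sin (k * y - k * f t)) <=
  (/ (1 - e)) ^ n * k * Rabs (x - y).
Proof.
  intros Hk. rewrite <- Rmult_minus_distr_l, Rabs_mult, Rmult_assoc.
  assert (Hr := radius_pos t).
  assert (H0 : 0 <= a / r t) by (apply Rlt_le, Rdiv_lt_0_compat; lra).
  apply Rmult_le_compat; try apply Rabs_pos.
  - rewrite Rabs_right by (apply Rle_ge, pow_le, H0).
    apply pow_incr. split; trivial.
    replace (/ (1 - e)) with (a / (a * (1 - e))) by (field; lra).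
    unfold Rdiv. apply Rmult_le_compat_l; [lra |].
    apply Rinv_le_contravar; [apply Rmult_lt_0_compat; lra |].
    apply radius_lower_bound.
  - eapply Rle_trans; [apply sin_lipschitz |].
    replace (k * x - k * f t - (k * y - k * f t)) with (k * (x - y)) by ring.
    rewrite Rabs_mult, (Rabs_right k) by lra. lra.
Qed.

Lemma weighted_sin_lipschitz_force (n : nat) (k : R) : 0 <= k ->
  lipschitz_force (fun t x => (a / r t) ^ n * sin (k * x - k * f t)).
Proof.
  intros Hk. eexists. intros t x y. now apply weighted_sin_lipschitz.
Qed.

Lemma force_lipschitz : lipschitz_force g.
Proof.
  assert (H23 := weighted_sin_lipschitz_force 3 2 ltac:(lra)).
  assert (H25 := weighted_sin_lipschitz_force 5 2 ltac:(lra)).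
  assert (H45 := weighted_sin_lipschitz_force 5 4 ltac:(lra)).
  unfold g. destruct eqn; simpl.
  1, 2: now apply lipschitz_force_scal.
  unfold spin_with_sphere.
  apply lipschitz_force_scal, lipschitz_force_plus; [exact H23 |].
  set (q := 25 * qhat a E1 / 28). set (p := 25 * _ * _ / 8).
  (* The fifth power is distributed over the bracket, leaving a linear combination of weighted
     sines. *)
  apply (lipschitz_force_ext (fun t x =>
    q * ((a / r t) ^ 5 * sin (2 * x - 2 * f t)) +
    p * ((a / r t) ^ 5 * sin (4 * x - 4 * f t)))); [intros; ring |].
  now apply lipschitz_force_plus; apply lipschitz_force_scal.
Qed.

End Kepler.

Theorem proposition5 (E1 E2 : ellipsoid) (a e : R) (u f : R -> R)
    (eqn : equation)
    (Ha : 0 < a) (He : 0 <= e < 1)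
    (HE1 : admissible E1) (HE2 : admissible E2)
    (HM : mass E1 + mass E2 = 1) (HC : momC E1 + momC E2 = 1)
    (Hu : solves_kepler e u) (Hf : true_anomaly a e u f) :
  let g := eq_term E1 E2 a (radius a e u) f eqn in
  (forall m n : Z, n <> 0%Z ->
     (forall theta : R -> R, is_solution g theta ->
        (has_symmetric_orbit g theta /\ standard_resonance m n theta <->
         exists (theta' : R -> R) (al be : R),
           is_solution g theta' /\ identified theta theta' /\
           (al = 0 \/ al = PI) /\ (be = 0 \/ be = PI / 2) /\
           dirichlet al be m n theta')) /\
     (forall (theta : R -> R) (al be : R), is_solution g theta ->
        (al = 0 \/ al = PI) -> (be = 0 \/ be = PI / 2) ->
        (symmetric_orbit g al be (initial_state theta) /\
           standard_resonance m n theta <->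
         dirichlet al be m n theta) /\
        (dirichlet al be m n theta ->
         forall t, theta t = 2 * be - theta (2 * al - t)))) /\
  (forall m : Z,
     (forall theta : R -> R, is_solution g theta ->
        (has_symmetric_orbit g theta /\ balanced_resonance m theta <->
         exists theta' : R -> R,
           is_solution g theta' /\ identified theta theta' /\
           (type_zero m theta' \/ type_half_pi m theta'))) /\
     (forall theta1 theta2 : R -> R,
        is_solution g theta1 -> is_solution g theta2 ->
        type_zero m theta1 -> type_half_pi m theta2 ->
        ~ identified theta1 theta2) /\
     (forall theta : R -> R, is_solution g theta -> type_zero m theta ->
        forall t, theta t = - theta (- t)) /\
     (forall theta : R -> R, is_solution g theta -> type_half_pi m theta ->
        forall t, theta t = PI - theta (- t))).
Proof.
  intros g.
  assert (HL := force_lipschitz E1 E2 a e u f eqn Ha He). fold g in HL.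
  assert (HT := force_translation_invariant E1 E2 a e u f eqn Ha He Hu Hf).
  fold g in HT.
  assert (HR := force_reflection_equivariant E1 E2 a e u f eqn Ha He Hu Hf).
  fold g in HR.
  split.
  - intros m n _. split.
    + intros theta Hth. now apply standard_resonance_characterization.
    + intros theta al be Hth Hal Hbe. split.
      * now apply symmetric_standard_dirichlet.
      * intros HD t.
        destruct (dirichlet_reflects g HL HR m n theta al be Hth Hal Hbe HD)
          as [Hr _].
        rewrite Hr. ring.
  - intros m. split; [|split; [|split]].
    + intros theta Hth. now apply balanced_resonance_characterization.
    + intros theta1 theta2 Hth1 _. now apply (balanced_types_distinct g HL HR).
    + intros theta Hth H t.
      destruct (type_zero_reflects g HL HR m theta Hth H) as [Hr _].
      specialize (Hr t). rewrite Rmult_0_r, Rminus_0_l in Hr. lra.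
    + intros theta Hth H t.
      destruct (type_half_pi_reflects g HL HR m theta Hth H) as [Hr _].
      specialize (Hr t). rewrite Rmult_0_r, Rminus_0_l in Hr. lra.
Qed.
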